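(* Let $\mathcal{D}=\langle \mathcal{N},\mathcal{E},\mathscr{T},c,v\rangle$ be a path-planning domain with visibility constraints in which all edges in $\mathcal{E}$ are undirected, i.e. $(i,j)\in\mathcal{E}\Rightarrow(j,i)\in\mathcal{E}$. Then, for $k\in\mathbb{Z}_{>0}$, $\ell\in\mathbb{R}_{\ge0}$ and finite $m\in\mathbb{Z}_{>0}$, the Random-Walk-based Planner (Rbp) satisfies $(k,\ell,m)$-Anonymity for $\mathcal{D}$.
   Context: Domain: $\mathcal{N}$ is a non-empty set of nodes, $\mathcal{E}\subseteq\mathcal{N}\times\mathcal{N}$ a set of edges without self-loops, $\mathscr{T}\subseteq\mathcal{N}$ the transit candidates, $c:\mathcal{E}\to\mathbb{R}_{\ge 0}$ the edge cost, $v:\mathcal{N}\to 2^{\mathcal{N}}$ the visibility function. A path $\pi=n_1,\dots,n_{|\pi|}$ is a sequence of nodes with $(n_i,n_{i+1})\in\mathcal{E}$ (nodes may repeat); its cost is the sum of its edge costs; it covers a node $n$ if $n\in v(n_i)$ for some $i$. $d(a,b)$ is the minimum cost of a path from $a$ to $b$, with the convention $d(a,a)=\infty$. $\pi|_m$ is the sequence of the first $m$ nodes of $\pi$, with $\pi|_m=\pi$ if $m>|\pi|$. Planner: a path planner $\mathcal{A}$ maps a tuple $\langle\mathcal{D},s,g,t\rangle$ ($s,g\in\mathcal{N}$, $t\in\mathscr{T}$) to a path from $s$ to $g$ covering $t$, or to Failure; by convention Failure $\ne$ Failure. Anonymity: for $s\ne t$, $g\ne t$, the path $\mathcal{A}(\langle\mathcal{D},s,g,t\rangle)$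 is a $(k,\ell,m)$-Anonymized Path with respect to $t$ if there is a set $T\subseteq\{t'\in\mathscr{T} : \mathcal{A}(\langle\mathcal{D},s,g,t\rangle)|_m=\mathcal{A}(\langle\mathcal{D},s,g,t'\rangle)|_m\}$ with $|T|\ge k$ and $\min_{(i,j)\in T\times T}d(i,j)\ge\ell$. A tuple $\langle\mathcal{D},s,g,t\rangle$ with $s\neq t$, $g\neq t$ is a $(k,\ell,m)$-Anonymizable Tuple if there is some path planner $\mathcal{A}$ for which such a $T$ exists. A planner satisfies $(k,\ell,m)$-Anonymity for $\mathcal{D}$ if it returns a $(k,\ell,m)$-Anonymized Path for all $(k,\ell,m)$-Anonymizable Tuples in $\mathcal{D}$. Random-Walk-based Planner (Rbp): the first $m$ nodes of the output path are chosen by a random walk: $\pi_1=s$, and for $2\le i\le m$, $\pi_i$ is picked at random among the neighbors of $\pi_{i-1}$. This prefix $\pi|_m$ is the same for all transit candidates $t\in\mathscr{T}$ (for given $\mathcal{D},s,g$). The planner then continues along shortest paths from $\pi_m$ to a node from which $t$ is covered, and from there to $g$. It outputs Failure if there is no feasible path. *)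

(* Defs.v *)
From mathcomp Require Import all_boot all_order all_algebra.
From mathcomp Require Import all_classical all_reals all_analysis.
Set Implicit Arguments.
Unset Strict Implicit.
Unset Printing Implicit Defensive.
Import Order.TTheory GRing.Theory Num.Theory.
Local Open Scope classical_set_scope.
Local Open Scope card_scope.
Local Open Scope ring_scope.

(* The node set may be infinite; pointedType makes it non-empty. The value of
   [cost] outside [edge] is irrelevant: only edges of paths are ever summed. *)
Record domain (R : realType) := Domain {
  node :> pointedType;
  edge : set (node * node);
  transit : set node;
  cost : node * node -> R;
  visible : node -> set node;
  edge_irrefl : forall x, ~ edge (x, x);
  cost_ge0 : forall e, edge e -> 0 <= cost e
}.

Definition undirected (R : realType) (D : domain R) : Prop :=
  forall i j : D, edge (i, j) -> edge (j, i).

Section Paths.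
Variables (R : realType) (D : domain R).
Implicit Types (a b n : D) (p : seq D).

(* Nodes may repeat, and [:: a] is a path from a to a of cost 0. *)
Definition is_path a b p : Prop :=
  if p is x :: p' then
    [/\ x = a, path (fun y z => (y, z) \in @edge R D) x p' & last x p' = b]
  else False.

Definition path_cost p : R := \sum_(e <- zip p (behead p)) cost e.

Definition covers p n : Prop := exists2 x, x \in p & visible x n.

(* The infimum over no path at all is +oo; it is the minimum whenever a path of
   minimum cost exists, in particular on every finite domain. *)
Definition dist a b : \bar R :=
  if a == b then +oo%E
  else ereal_inf [set (path_cost p)%:E | p in [set p | is_path a b p]].

(* Not phrased with [dist], because dist a a = +oo. *)
Definition shortest_path a b p : Prop :=
  is_path a b p /\ forall q, is_path a b q -> path_cost p <= path_cost q.

End Paths.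

(* None is Failure; only the values at transit candidates t matter. *)
Record planner (R : realType) := Planner {
  plan :> forall D : domain R, D -> D -> D -> option (seq D);
  planP : forall (D : domain R) (s g t : D) (p : seq D),
    transit t -> plan s g t = Some p -> is_path s g p /\ covers p t
}.

(* Failure differs from Failure, hence False as soon as one side is None. *)
Definition same_prefix (T : Type) (m : nat) (o1 o2 : option (seq T)) : Prop :=
  if o1 is Some p1 then
    if o2 is Some p2 then take m p1 = take m p2 else False
  else False.

Section Anonymity.
Variables (R : realType) (k : nat) (l : R) (m : nat).

Definition anonymity_set (A : planner R) (D : domain R) (s g t : D)
    (T : set D) : Prop :=
  [/\ T `<=` [set t' | transit t' /\ same_prefix m (A D s g t) (A D s g t')],
      `I_k #<= T
    & (l%:E <= ereal_inf [set dist ij.1 ij.2 | ij in T `*` T])%E].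

Definition anonymized_path (A : planner R) (D : domain R) (s g t : D) : Prop :=
  [/\ transit t, s <> t, g <> t & exists T, anonymity_set A s g t T].

Definition anonymizable (D : domain R) (s g t : D) : Prop :=
  [/\ transit t, s <> t, g <> t
    & exists (A : planner R) (T : set D), anonymity_set A s g t T].

Definition satisfies_anonymity (A : planner R) (D : domain R) : Prop :=
  forall s g t : D, anonymizable s g t -> anonymized_path A s g t.

End Anonymity.

Section RandomWalkPlanner.
Variables (R : realType) (D : domain R).

(* The possible outcomes of a random walk meant to visit m nodes from s. It can
   only fall short of m nodes by reaching a node that has no neighbor, from
   which no next node can be picked. *)
Definition walk_outcome (m : nat) (s : D) (w : seq D) : Prop :=
  [/\ is_path s (last s w) w, (size w <= m)%N
    & (size w < m)%N -> forall x : D, ~ edge (last s w, x)].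

(* The path is w, followed by a shortest path from the last node of w to some
   node u seeing t, followed by a shortest path from u to g; [behead] removes
   the duplicated junction nodes. *)
Definition rbp_output (w : seq D) (s g t : D) (o : option (seq D)) : Prop :=
  if o is Some p then
    exists (u : D) (q1 q2 : seq D),
      [/\ visible u t, shortest_path (last s w) u q1, shortest_path u g q2
        & p = w ++ behead q1 ++ behead q2]
  else
    ~ exists (u : D) (q1 q2 : seq D),
      [/\ visible u t, is_path (last s w) u q1 & is_path u g q2].

(* A is, on D, one possible realization of the random planner: whatever nodes
   the walk picks, and whichever u and shortest paths are used. The walk w may
   depend on s and g but is common to all t. *)
Definition is_rbp (m : nat) (A : planner R) : Prop :=
  forall s g : D, exists2 w, walk_outcome m s w
    & forall t : D, transit t -> rbp_output w s g t (A D s g t).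

End RandomWalkPlanner.

(* Main.v *)
Require Import Defs.
From mathcomp Require Import all_boot all_order all_algebra.
From mathcomp Require Import all_classical all_reals all_analysis.
Set Implicit Arguments.
Unset Strict Implicit.
Unset Printing Implicit Defensive.
Import Order.TTheory GRing.Theory Num.Theory.
Local Open Scope ring_scope.

(** If some planner succeeds on [(s, g, t')], then [t'] is visible from a node
    connected to both [s] and [g]. Since edges are undirected, the endpoint of
    the random walk is connected back to [s], so Rbp succeeds on [(s, g, t')]
    as well, and its first [m] nodes are the walk, which does not depend on
    [t']. Undirectedness also shows that the walk can stop early only when [s]
    is isolated, in which case every path from [s] is trivial. Hence the set
    [T] witnessing anonymizability for any planner is a witness for Rbp. *)

Section PathOperations.
Variables (R : realType) (D : domain R).
Implicit Types (a b x : D) (p q : seq D).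

Lemma is_path_cat a b x p q :
  is_path a b p -> is_path b x q -> is_path a x (p ++ behead q).
Proof.
case: p => [//|y p] [-> pp lp]; case: q => [//|z q] [zb pq lq].
split=> //=; first by rewrite cat_path pp lp -zb.
by rewrite last_cat lp -zb.
Qed.

Lemma is_path_rev a b p :
  undirected D -> is_path a b p -> is_path b a (rev p).
Proof.
move=> symD; case: p => [//|y p] [-> pp lp].
rewrite lastI lp rev_rcons; split=> //.
- rewrite -lp rev_path; apply: sub_path pp => u v.
  by rewrite !inE; exact: symD.
- by case: p {pp} lp => [|z p] //= _; rewrite rev_cons last_rcons.
Qed.

Lemma is_path_split a b x p :
  is_path a b p -> x \in p ->
  exists p1 p2, is_path a x p1 /\ is_path x b p2.
Proof.
case: p => [//|y p] [-> pp lp] xp; case/splitPl: xp pp lp => p1 p2 lp1.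
rewrite cat_path last_cat lp1 => /andP[pp1 pp2] lp2.
by exists (a :: p1), (x :: p2).
Qed.

Lemma isolated_path a b p :
  (forall x, ~ edge (a, x)) -> is_path a b p -> p = [:: a].
Proof.
by move=> iso; case: p => [//|y [|z p]] [->] //= /andP[]; rewrite inE => /iso.
Qed.

(** A walk that stops early ends at a node without neighbors. Its reversal is a path starting at
    that node, so it has a single node, which must be [s]. *)
Lemma walk_outcome_full m (s : D) w :
  undirected D -> walk_outcome m s w ->
  size w = m \/ w = [:: s] /\ forall x, ~ edge (s, x).
Proof.
move=> symD [wP]; rewrite leq_eqVlt.
case/orP=> [/eqP|ltwm /(_ ltwm) iso]; first by left.
right; have := is_path_rev symD wP => /(isolated_path iso) /(congr1 rev).
rewrite revK => wE; rewrite wE /= in wP iso *.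
by case: wP iso => ->.
Qed.

Lemma rbp_prefix m (s g t : D) w p :
  undirected D -> walk_outcome m s w -> rbp_output w s g t (Some p) ->
  take m p = take m w.
Proof.
move=> symD wm [u [q1 [q2 [_ [q1P _] [q2P _] ->]]]].
case: (walk_outcome_full symD wm) => [<-|[wE iso]].
  by rewrite take_size take_size_cat.
(* With [s] isolated, [q1] and [q2] are both [[:: s]], so the output is [w] itself. *)
move: q1P; rewrite wE /= => q1P; have q1E := isolated_path iso q1P.
by move: q1P q2P; rewrite q1E => -[_ _ /= <-] /(isolated_path iso) ->.
Qed.

Lemma rbp_succeeds m (s g t : D) w o p :
  undirected D -> walk_outcome m s w -> rbp_output w s g t o ->
  is_path s g p -> covers p t -> exists p', o = Some p'.
Proof.
move=> symD [wP _ _]; case: o => [p' _ _ _|]; first by exists p'.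
move=> infeasible pP [u up ut]; case: infeasible.
have [p1 [p2 [p1P p2P]]] := is_path_split pP up.
(* Retrace the walk back to [s], then follow [p] to [u]; the rest of [p] leads on to [g]. *)
exists u, (rev w ++ behead p1), p2; split=> //.
exact: is_path_cat (is_path_rev symD wP) p1P.
Qed.

End PathOperations.

Theorem proposition3 (R : realType) (D : domain R) (k : nat) (l : R) (m : nat)
    (A : planner R) :
  undirected D -> (0 < k)%N -> 0 <= l -> (0 < m)%N ->
  is_rbp D m A -> satisfies_anonymity k l m A D.
Proof.
move=> symD k0 _ _ rbpA s g t [tt st gt [B [T [TB kT lT]]]].
split=> //; exists T; split=> // t' Tt'.
have [tt' BB] := TB _ Tt'; split=> //.
have [w wm wA] := rbpA s g.
have succeeds r p : transit r -> B D s g r = Some p ->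
    exists p', A D s g r = Some p'.
  move=> tr Br; have [pP pr] := planP tr Br.
  exact: rbp_succeeds symD wm (wA r tr) pP pr.
(* Failure shares no prefix with anything, so [B] succeeds on both [t] and [t']. *)
move: BB; rewrite /Defs.same_prefix.
case Bt: (B D s g t) => [p|//]; case Bt': (B D s g t') => [p'|//] _.
have [q qE] := succeeds _ _ tt Bt; have [q' qE'] := succeeds _ _ tt' Bt'.
have := wA _ tt; have := wA _ tt'; rewrite qE qE' => rt' rt.
by rewrite (rbp_prefix symD wm rt) (rbp_prefix symD wm rt').
Qed.
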